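(* Let $\mathfrak{F}$ be a (Kripke or descriptive) frame and $\mathfrak{N}$ a finite rooted $n$-model. Then $\mathfrak{F}\not\models\beta(\mathfrak{N})$ if and only if there is a color-consistent monotonic map from the unraveling $\mathfrak{N}_{\mathsf t}$ into $\mathfrak{F}$.
   Context: Formulas are built from propositional variables and $\bot$ by $\wedge,\vee,\to$. A Kripke frame is $(W,R)$ with $W\neq\emptyset$ and $R$ a partial order. A general frame is $(W,R,\mathcal P)$ with $(W,R)$ a Kripke frame and $\mathcal P$ a set of upsets containing $\emptyset,W$, closed under $\cup,\cap$ and $U_0\to U_1:=\{w\mid \forall v\,(wRv\text{ and }v\in U_0\text{ imply }v\in U_1)\}$. It is refined if $\neg wRv$ implies there is $U\in\mathcal P$ with $w\in U$, $v\notin U$; it is compact if every $\mathcal X\subseteq\mathcal P\cup\{W\setminus U\mid U\in\mathcal P\}$ with the finite intersection property has $\bigcap\mathcal X\ne\emptyset$; it is descriptive if it is refined and compact. A Kripke frame is regarded as a general frame with $\mathcal P$ the set of all upsets. A model is a (Kripke or descriptive) frame with a valuation $V$ such that $V(p)\in\mathcal P$ for each variable $p$; truth at a world is the standard intuitionistic Kripke semantics. $\mathfrak F\models\varphi$ means $\varphi$ is true at all worlds of all models on $\mathfrak F$. An $n$-model is a model whose valuation is restricted to $n$ fixed variables $p_1,\dots,p_n$. The color $col(w)\in\{0,1\}^n$ of a world $w$ in an $n$-model is the sequence whose $k$-th entry is $1$ iff $p_k$ is true at $w$; colors are ordered coordinatewise by $\leq$. A monotonic map is an order-preserving function between worlds.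 A monotonic map $f$ from an $n$-model $\mathfrak N$ into a frame $\mathfrak F$ with order $R$ is color-consistent if for all points $w,u$ of $\mathfrak N$: $f(w)Rf(u)$ implies $col(w)\leq col(u)$. For a finite $n$-model $\mathfrak N$ and a world $w$, let $prop(w)$ be the set of those $p_i$ ($1\le i\le n$) true at $w$ and $notprop(w)$ the set of those $p_i$ not true at $w$. The formula $\beta(w)$ is defined by induction on the depth of $w$ by $\beta(w):=\bigwedge prop(w)\to\bigvee notprop(w)\vee\bigvee_{i=1}^k\beta(w_i)$, where $w_1,\dots,w_k$ are all immediate successors of $w$ (for $w$ maximal, $\beta(w):=\bigwedge prop(w)\to\bigvee notprop(w)$). Empty conjunctions are true, empty disjunctions are $\bot$. If $\mathfrak N$ is rooted with root $r$, $\beta(\mathfrak N):=\beta(r)$. For a finite rooted model $\mathfrak N$ with root $r$, the unraveling $\mathfrak N_{\mathsf t}$ is the finite tree model whose worlds are the sequences $\langle r,w_1,\dots,w_k\rangle$ ($k\ge 0$) in which each entry is an immediate successor of the previous one, ordered by the initial segment relation, with each sequence having the color of its last entry. *)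

(* Defs.v *)
From HB Require Import structures.
From mathcomp Require Import all_boot all_order.
From mathcomp Require Import all_classical.

Set Implicit Arguments.
Unset Strict Implicit.
Unset Printing Implicit Defensive.

Local Open Scope classical_set_scope.

Inductive form : Type :=
| Var of nat
| Bot
| And of form & form
| Or of form & form
| Imp of form & form.

Definition Top : form := Imp Bot Bot.

Fixpoint bigAnd (s : seq form) : form :=
  match s with
  | [::] => Top
  | [:: a] => a
  | a :: s' => And a (bigAnd s')
  end.

Fixpoint bigOr (s : seq form) : form :=
  match s with
  | [::] => Bot
  | [:: a] => a
  | a :: s' => Or a (bigOr s')
  end.

Record kframe : Type := KFrame {
  world :> Type;
  le : world -> world -> Prop;
  world_inhabited : inhabited world;
  le_refl : forall w, le w w;
  le_trans : forall u v w, le u v -> le v w -> le u w;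
  le_anti : forall u v, le u v -> le v u -> u = v }.

Arguments le {k} _ _.

Definition upset (K : kframe) (U : set K) : Prop :=
  forall u v, le u v -> U u -> U v.

Definition set_imp (K : kframe) (U0 U1 : set K) : set K :=
  [set w | forall v, le w v -> U0 v -> U1 v].

Record gframe : Type := GFrame {
  kframe_of :> kframe;
  adm : set (set kframe_of);
  adm_upset : forall U, adm U -> upset U;
  adm0 : adm set0;
  admT : adm setT;
  admU : forall U0 U1, adm U0 -> adm U1 -> adm (U0 `|` U1);
  admI : forall U0 U1, adm U0 -> adm U1 -> adm (U0 `&` U1);
  adm_imp : forall U0 U1, adm U0 -> adm U1 -> adm (set_imp U0 U1) }.

Arguments adm {g}.

Lemma upset0 (K : kframe) : upset (set0 : set K).
Proof. by []. Qed.

Lemma upsetT (K : kframe) : upset (setT : set K).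
Proof. by []. Qed.

Lemma upsetU (K : kframe) (A B : set K) :
  upset A -> upset B -> upset (A `|` B).
Proof.
by move=> hA hB u v uv [/(hA _ _ uv)|/(hB _ _ uv)]; [left|right].
Qed.

Lemma upsetI (K : kframe) (A B : set K) :
  upset A -> upset B -> upset (A `&` B).
Proof. by move=> hA hB u v uv [/(hA _ _ uv) ? /(hB _ _ uv)]. Qed.

Lemma upset_imp (K : kframe) (A B : set K) :
  upset A -> upset B -> upset (set_imp A B).
Proof. by move=> _ _ u v uv h w vw; apply: h; apply: le_trans vw. Qed.

Definition gframe_of_kframe (K : kframe) : gframe :=
  @GFrame K [set U | upset U] (fun U h => h) (@upset0 K) (@upsetT K)
    (@upsetU K) (@upsetI K) (@upset_imp K).

Definition is_kripke (F : gframe) : Prop := adm = [set U : set F | upset U].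

Definition refined (F : gframe) : Prop :=
  forall w v : F, ~ le w v -> exists U : set F, [/\ adm U, U w & ~ U v].

Definition fin_inter_prop (T : Type) (X : set (set T)) : Prop :=
  forall Y, finite_set Y -> Y `<=` X -> \bigcap_(A in Y) A !=set0.

Definition compact_frame (F : gframe) : Prop :=
  forall X : set (set F),
    X `<=` adm `|` [set ~` U | U in adm] ->
    fin_inter_prop X -> \bigcap_(A in X) A !=set0.

Definition descriptive (F : gframe) : Prop := refined F /\ compact_frame F.

Record valuation (I : Type) (F : gframe) : Type := Valuation {
  val_fun :> I -> set F;
  val_adm : forall i, adm (val_fun i) }.

Fixpoint forces (F : gframe) (V : valuation nat F) (w : F) (phi : form) : Prop :=
  match phi with
  | Var p => V p w
  | Bot => False
  | And a b => forces V w a /\ forces V w b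
  | Or a b => forces V w a \/ forces V w b
  | Imp a b => forall v, le w v -> forces V v a -> forces V v b
  end.

Definition valid (F : gframe) (phi : form) : Prop :=
  forall (V : valuation nat F) (w : F), forces V w phi.

(* The fixed variables of an n-model are Var 0, ..., Var (n - 1). *)
Record nmodel (n : nat) : Type := NModel {
  frame_of :> gframe;
  nval : valuation 'I_n frame_of }.

Definition col n (M : nmodel n) (w : M) : {ffun 'I_n -> bool} :=
  [ffun k => `[< nval M k w >]].

Definition col_le n (c d : {ffun 'I_n -> bool}) : Prop :=
  forall k, (c k <= d k)%N.

Definition monotonic (K L : kframe) (f : K -> L) : Prop :=
  forall u v, le u v -> le (f u) (f v).

Definition color_consistent n (M : nmodel n) (F : gframe) (f : M -> F) : Prop :=
  forall w u : M, le (f w) (f u) -> col_le (col w) (col u).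

Record rfmodel (n : nat) : Type := RFModel {
  rf_disp : Order.disp_t;
  rf_world : finPOrderType rf_disp;
  rf_root : rf_world;
  rf_root_le : forall w, (rf_root <= w)%O;
  rf_val : 'I_n -> {set rf_world};
  rf_val_up : forall k (u v : rf_world),
    (u <= v)%O -> u \in rf_val k -> v \in rf_val k }.

Section RFModel.
Context (n : nat) (N : rfmodel n).
Local Notation W := (rf_world N).
Local Notation r := (rf_root N).

Definition rf_kframe : kframe :=
  @KFrame W (fun u v => (u <= v)%O) (inhabits r) (@Order.POrderTheory.lexx _ W)
    (fun u v w uv vw => Order.POrderTheory.le_trans uv vw)
    (fun u v uv vu => Order.POrderTheory.le_anti (introT andP (conj uv vu))).

Definition rf_nmodel : nmodel n :=
  @NModel n (gframe_of_kframe rf_kframe)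
    (@Valuation 'I_n (gframe_of_kframe rf_kframe)
       (fun k => [set w : W | w \in rf_val N k]) (@rf_val_up n N)).

Definition imm_succ (u v : W) : bool :=
  (u < v)%O && [forall w : W, ~~ ((u < w)%O && (w < v)%O)].

Definition prop_of (w : W) : seq form :=
  [seq Var (nat_of_ord k) | k <- enum 'I_n & @col n rf_nmodel w k].

Definition notprop_of (w : W) : seq form :=
  [seq Var (nat_of_ord k) | k <- enum 'I_n & ~~ @col n rf_nmodel w k].

Definition beta_step (w : W) (betas : seq form) : form :=
  Imp (bigAnd (prop_of w))
    (if betas is [::] then bigOr (notprop_of w)
     else Or (bigOr (notprop_of w)) (bigOr betas)).

(* The fuel #|W| is never exhausted; betaE is the defining equation. *)
Fixpoint beta_fuel (m : nat) (w : W) : form :=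
  if m is m'.+1 then
    beta_step w [seq beta_fuel m' v | v <- enum W & imm_succ w v]
  else Bot.

Definition beta (w : W) : form := beta_fuel #|W| w.

Lemma beta_fuel_irrel m m' (w : W) :
  #|[pred v : W | (w < v)%O]| < m -> #|[pred v : W | (w < v)%O]| < m' ->
  beta_fuel m w = beta_fuel m' w.
Proof.
elim: m m' w => [//|m IH] [//|m'] w; rewrite !ltnS => hm hm' /=.
congr beta_step; apply/eq_in_map => v; rewrite mem_filter => /andP[/andP[wv _] _].
have lt : #|[pred u : W | (v < u)%O]| < #|[pred u : W | (w < u)%O]|.
  apply: proper_card; apply/properP; split.
    by apply/fintype.subsetP => u; rewrite !inE; apply: Order.POrderTheory.lt_trans.
  by exists v; rewrite !inE // Order.POrderTheory.ltxx.
by apply: IH; [apply: leq_trans hm|apply: leq_trans hm'].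
Qed.

Lemma betaE (w : W) :
  beta w = beta_step w [seq beta v | v <- enum W & imm_succ w v].
Proof.
have lt (v : W) : #|[pred u : W | (v < u)%O]| < #|W|.
  apply: proper_card; apply/properP; split; first exact: subset_predT.
  by exists v; rewrite // inE Order.POrderTheory.ltxx.
rewrite /beta (@beta_fuel_irrel #|W| #|W|.+1) ?lt //.
by rewrite ltnW // ltnS.
Qed.

Definition beta_model : form := beta r.

(* A sequence <r, w_1, ..., w_k> is represented by [:: w_1; ...; w_k], so its
   last entry is last r [:: w_1; ...; w_k]. *)
Definition branch : Type := {s : seq W | path imm_succ r s}.

Definition branch_le (s t : branch) : Prop := prefix (val s) (val t).

Definition branch_last (s : branch) : W := last r (val s).

Lemma branch_le_anti (s t : branch) : branch_le s t -> branch_le t s -> s = t.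
Proof.
rewrite /branch_le => st ts; apply: val_inj.
have /eqP e : size (val s) == size (val t).
  by rewrite eqn_leq !size_prefix.
by move: st; rewrite prefixE e take_size => /eqP.
Qed.

Definition unravel_kframe : kframe :=
  @KFrame branch branch_le (inhabits (exist _ [::] isT))
    (fun s => prefix_refl (val s))
    (fun s t u st tu => prefix_trans st tu) branch_le_anti.

Lemma path_imm_succ_le (x : W) s : path imm_succ x s -> (x <= last x s)%O.
Proof.
elim: s x => [|y s IH] x /=; first by rewrite Order.POrderTheory.lexx.
move=> /andP[/andP[xy _] /IH]; apply: Order.POrderTheory.le_trans.
exact: Order.POrderTheory.ltW.
Qed.

Lemma unravel_val_up k :
  upset ([set s : branch | branch_last s \in rf_val N k] : set unravel_kframe).
Proof.
move=> [s ps] [t pt] /prefixP[/= u e]; rewrite /branch_last /=; apply: rf_val_up.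
by subst t; move: pt; rewrite last_cat cat_path => /andP[_ /path_imm_succ_le].
Qed.

Definition unravel : nmodel n :=
  @NModel n (gframe_of_kframe unravel_kframe)
    (@Valuation 'I_n (gframe_of_kframe unravel_kframe)
       (fun k => [set s : branch | branch_last s \in rf_val N k])
       unravel_val_up).

Lemma col_unravel (s : branch) :
  @col n unravel s = @col n rf_nmodel (branch_last s).
Proof. by apply/ffunP => k; rewrite !ffunE. Qed.

End RFModel.

(* Main.v *)
(* A world refuting [beta x] lies below one that has exactly the color of [x]
   and refutes [beta y] for every immediate successor [y] of [x]. Iterating this
   along the branches of the unraveling gives the map, color-consistent because
   colors in a model increase along the order. Conversely, the unraveling is
   finite and Kripke frames are refined too, so for each variable the images of
   the points where it is true can be separated from the remaining images by an
   admissible upset. With these upsets as valuation, [f s] has the color of [s],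
   and [f s] refutes [beta] of the last entry of [s]. *)

From mathcomp Require Import all_boot all_order.
From mathcomp Require Import all_classical.
Require Import Defs.

Set Implicit Arguments.
Unset Strict Implicit.
Unset Printing Implicit Defensive.

Local Open Scope classical_set_scope.

Lemma forces_bigAnd (F : gframe) (V : valuation nat F) (w : F) (I : eqType)
    (g : I -> form) (s : seq I) :
  forces V w (bigAnd [seq g i | i <- s]) <->
  forall i, i \in s -> forces V w (g i).
Proof.
elim: s => [|a [|b s] IH].
- by split=> // _ v _ [].
- by split=> [h i|h]; [rewrite inE => /eqP-> | apply: h; rewrite inE].
split=> [[ha /IH hs] i|h].
  by rewrite inE => /orP[/eqP->|/hs].
split; first by apply: h; rewrite mem_head.
by apply/IH => i hi; apply: h; rewrite inE hi orbT.
Qed.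

Lemma forces_bigOr (F : gframe) (V : valuation nat F) (w : F) (I : eqType)
    (g : I -> form) (s : seq I) :
  forces V w (bigOr [seq g i | i <- s]) <->
  exists2 i, i \in s & forces V w (g i).
Proof.
elim: s => [|a [|b s] IH].
- by split=> // -[].
- split=> [h|[i]]; first by exists a; rewrite ?inE.
  by rewrite inE => /eqP->.
split=> [[ha|/IH[i hi h]]|[i]].
- by exists a; rewrite ?mem_head.
- by exists i; rewrite // inE hi orbT.
rewrite inE => /orP[/eqP->|hi h]; first by left.
by right; apply/IH; exists i.
Qed.

Section Refutation.
Context (n : nat) (N : rfmodel n) (F : gframe) (V : valuation nat F).
Local Notation W := (rf_world N).

Definition same_color (x : W) (v : F) : Prop :=
  forall k : 'I_n, V (nat_of_ord k) v <-> x \in rf_val N k.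

(** The antecedent of [beta x], forced at [v], makes the variables of [x] true there; the refuted
    disjunction makes the others false and refutes each [beta y]. *)
Lemma forces_betaN (x : W) (w : F) :
  ~ forces V w (beta x) <->
  exists v, [/\ le w v, same_color x v &
             forall y, imm_succ x y -> ~ forces V v (beta y)].
Proof.
have colE k : @col n (rf_nmodel N) x k = (x \in rf_val N k).
  by rewrite ffunE; apply/asboolP/idP.
(* Removes the case split of [beta_step]: with no immediate successor, the omitted disjunct is an
   empty disjunction, hence false. *)
have stepE v :
    forces V v (if [seq beta y | y <- enum W & imm_succ x y] is [::]
                then bigOr (notprop_of x)
                else Or (bigOr (notprop_of x))
                        (bigOr [seq beta y | y <- enum W & imm_succ x y])) <->
    forces V v (bigOr (notprop_of x)) \/
    exists2 y, imm_succ x y & forces V v (beta y).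
  have -> : (exists2 y, imm_succ x y & forces V v (beta y)) <->
      forces V v (bigOr [seq beta y | y <- enum W & imm_succ x y]).
    rewrite forces_bigOr; split=> -[y hy h]; exists y => //.
      by rewrite mem_filter hy mem_enum.
    by move: hy; rewrite mem_filter => /andP[].
  by case: [seq beta y | y <- _ & _] => [|b s] //=; split=> [|[|]//]; left.
rewrite betaE /beta_step; split=> [/= /existsNP[v]|[v [wv hc hs]] /= /(_ v wv)].
  move=> /not_implyP[wv /not_implyP[/forces_bigAnd hp /stepE /not_orP[hn hs]]].
  exists v; split=> // [k|y xy hy]; last by apply: hs; exists y.
  split=> hk.
    apply/negPn/negP => xk; apply: hn; apply/forces_bigOr.
    by exists k; rewrite // mem_filter colE xk mem_enum.
  by apply: hp; rewrite mem_filter colE hk mem_enum.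
have hp : forces V v (bigAnd (prop_of x)).
  apply/forces_bigAnd => k; rewrite mem_filter colE => /andP[xk _] /=.
  exact/hc.
move=> /(_ hp) /stepE [/forces_bigOr[k]|[y xy]]; last exact: hs.
by rewrite mem_filter colE => /andP[/negP xk _] /= /hc.
Qed.

Lemma map_of_refutation (w : F) :
  ~ forces V w (beta_model N) ->
  exists f : unravel N -> F, monotonic f /\ color_consistent f.
Proof.
pose good x v := same_color x v /\
  forall y, imm_succ x y -> ~ forces V v (beta y).
(* Where [beta xv.1] is forced nothing is asked of [g], and [xv.2] serves as a default value. *)
have /choice[g gP] (xv : W * F) : exists v', ~ forces V xv.2 (beta xv.1) ->
    le xv.2 v' /\ good xv.1 v'.
  have [h|/forces_betaN[v' [? ? ?]]] := pselect (forces V xv.2 (beta xv.1)).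
    by exists xv.2.
  by exists v'.
move=> /forces_betaN[v0 [_ c0 s0]].
pose h := foldl (fun v y => g (y, v)).
(* Arbitrary [x] and [v] let this apply from the root and also to the final segment of a longer
   branch, which yields monotonicity. *)
have hP s : forall x v, path (@imm_succ n N) x s -> good x v ->
    le v (h v s) /\ good (last x s) (h v s).
  elim: s => [|y s IH] x v /=; first by split; [exact: le_refl|].
  move=> /andP[xy ys] [_ /(_ y xy) /(gP (y, v))[/= le1 gd]].
  have [le2 gd2] := IH _ _ ys gd; split=> //; exact: le_trans le2.
have fP (s : branch N) : good (branch_last s) (h v0 (val s)).
  by have [] := hP _ _ _ (valP s) (conj c0 s0).
exists (fun s : branch N => h v0 (val s)); split.
  move=> s [t pt] /prefixP[/= u e]; subst t.
  rewrite /h foldl_cat; move: pt; rewrite cat_path => /andP[_ pu].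
  by have [] := hP _ _ _ pu (fP s).
move=> s t le_st k; rewrite !ffunE.
case: asboolP => //= sk; case: asboolP => // -[].
have [[cs _] [ct _]] := (fP s, fP t).
by apply/ct; apply: (adm_upset (val_adm V k) le_st); apply/cs.
Qed.

End Refutation.

Lemma kripke_refined (F : gframe) : is_kripke F -> refined F.
Proof.
move=> hK w v wv; exists [set u | le w u]; split=> //; last exact: le_refl.
by rewrite hK => u u' uu' wu; apply: le_trans uu'.
Qed.

(** For a fixed [a], upsets separating [f a] from each [f b] are intersected over [B]; the results
    are then united over [A]. Both operations are finite, so admissibility is kept. *)
Lemma refined_separate (F : gframe) (I : eqType) (f : I -> F) (A B : seq I) :
  refined F ->
  (forall a b, a \in A -> b \in B -> ~ le (f a) (f b)) ->
  exists U : set F, [/\ adm U, forall a, a \in A -> U (f a) &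
                        forall b, b \in B -> ~ U (f b)].
Proof.
move=> hF; elim: A => [|a A IHA] hAB.
  by exists set0; split=> [|//|b _ []]; exact: adm0.
have [|U [aU AU BU]] := IHA.
  by move=> a' b ha' hb; apply: hAB => //; rewrite inE ha' orbT.
have [V [aV VA VB]] : exists V : set F, [/\ adm V, V (f a) &
    forall b, b \in B -> ~ V (f b)].
  have {IHA U aU AU BU} : forall b, b \in B -> ~ le (f a) (f b).
    by move=> b; apply: hAB; rewrite mem_head.
  elim: B {hAB} => [|b B IHB] haB.
    by exists setT; split=> //; exact: admT.
  have [|V [aV Va VB]] := IHB.
    by move=> b' hb'; apply: haB; rewrite inE hb' orbT.
  have [V' [aV' V'a V'b]] := hF _ _ (haB b (mem_head _ _)).
  exists (V `&` V'); split=> [|//|b']; first exact: admI.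
  by rewrite inE => /orP[/eqP-> []|/VB nV []].
exists (U `|` V); split=> [|a'|b hb]; first exact: admU.
  by rewrite inE => /orP[/eqP->|/AU]; [right|left].
by case; [exact: BU|exact: VB].
Qed.

(** A branch is strictly increasing, so it repeats no world and its length is at most the number of
    worlds. *)
Lemma branches_finite n (N : rfmodel n) :
  exists e : seq (branch N), forall s, s \in e.
Proof.
exists (pmap insub [seq val b | b <- enum {: {bseq #|rf_world N| of rf_world N}}]).
move=> s; rewrite mem_pmap_sub.
have sorted_s : sorted <%O (rf_root N :: val s).
  by apply: sub_path (valP s) => x y /andP[].
have /card_uniqP us : uniq (val s).
  move: (Order.POrderTheory.lt_sorted_uniq sorted_s).
  by rewrite cons_uniq => /andP[].
have sz : size (val s) <= #|rf_world N| by rewrite -us max_card.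
by apply/mapP; exists (Bseq sz); rewrite ?mem_enum.
Qed.

Lemma refutation_of_map n (N : rfmodel n) (F : gframe) (f : unravel N -> F) :
  refined F -> monotonic f -> color_consistent f -> ~ valid F (beta_model N).
Proof.
move=> hF fmono fcol.
have [e eP] := branches_finite N.
have /choice[U UP] (k : 'I_n) : exists U : set F, adm U /\
    forall s : branch N, U (f s) <-> branch_last s \in rf_val N k.
  have [|U [aU hU nU]] := @refined_separate F (branch N) f
    [seq s <- e | branch_last s \in rf_val N k]
    [seq s <- e | branch_last s \notin rf_val N k] hF.
    (* Variable [k] is true at [s] and false at [t], so color-consistency forbids [f s] below
       [f t]. *)
    move=> s t; rewrite !mem_filter => /andP[sk _] /andP[tk _] /fcol/(_ k).
    by rewrite !col_unravel !ffunE !asboolb sk (negPf tk).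
  exists U; split=> // s; split=> [hs|sk]; last by apply: hU; rewrite mem_filter sk eP.
  by apply/negPn/negP => sk; apply: (nU s) hs; rewrite mem_filter sk eP.
(* Variables of index [n] or more, absent from [beta], get the empty upset. *)
pose Vf i := if insub i is Some k then U k else set0.
have Vadm i : adm (Vf i).
  by rewrite /Vf; case: insubP => [k _ _|_]; [case: (UP k)|exact: adm0].
pose V := Valuation Vadm.
(* [m] bounds the number of worlds strictly above the last entry, which drops at each immediate
   successor. *)
have main m : forall s : branch N,
    #|[pred v | (branch_last s < v)%O]| < m ->
    ~ forces V (f s) (beta (branch_last s)).
  elim: m => // m IH s; rewrite ltnS => hm; apply/forces_betaN; exists (f s); split.
  - exact: le_refl.
  - move=> k; rewrite /V /= /Vf valK; exact: (UP k).2.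
  move=> y sy; have pt : path (@imm_succ n N) (rf_root N) (rcons (val s) y).
    by rewrite rcons_path (valP s).
  pose t : branch N := exist _ (rcons (val s) y) pt.
  have ty : branch_last t = y by rewrite /branch_last /= last_rcons.
  have /fmono st : @le (unravel N) s t by apply/prefixP; exists [:: y]; rewrite /= cats1.
  have : ~ forces V (f t) (beta y).
    rewrite -{1}ty; apply: IH; rewrite ty; apply: leq_trans hm.
    have /andP[lt_sy _] := sy; apply: proper_card; apply/properP; split.
      apply/fintype.subsetP => u; rewrite !inE.
      exact: Order.POrderTheory.lt_trans.
    by exists y; rewrite !inE // Order.POrderTheory.ltxx.
  (* Refutation passes from [f t] down to [f s]: a witness above [f t] is also above [f s]. *)
  move=> /forces_betaN[v [tv cv sv]]; apply/forces_betaN; exists v; split=> //.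
  exact: le_trans tv.
(* The empty sequence encodes the branch consisting of the root alone. *)
move=> hval; apply: (main _ (exist _ [::] isT) (ltnSn _)); exact: hval.
Qed.

Theorem theorem3p7 (n : nat) (F : gframe) (hF : is_kripke F \/ descriptive F)
    (N : rfmodel n) :
  ~ valid F (beta_model N) <->
  exists f : unravel N -> F, monotonic f /\ color_consistent f.
Proof.
split=> [/existsNP[V /existsNP[w]]|[f [fmono fcol]]].
  exact: map_of_refutation.
apply: refutation_of_map fmono fcol.
by case: hF => [/kripke_refined|[]].
Qed.
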